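(* Let $(B,\cdot,\circ)$ be a completely simple left semi-brace such that the associated $\rho$-map is an anti-homomorphism. Then $\mathrm{Soc}(B)=\{x\in B\mid\lambda_x=\lambda_{1_{\circ}}\text{ and }\rho_x=\rho_{1_{\circ}}\}$ is an ideal of $B$.
   Context: A left semi-brace is a set $B$ with two operations $\cdot$ and $\circ$ such that $(B,\cdot)$ is a semigroup, $(B,\circ)$ is a group, and $a\circ(bc)=(a\circ b)(a\circ(\overline{a}c))$ for all $a,b,c\in B$ (here $xy$ means $x\cdot y$ and $\overline{a}$ is the inverse of $a$ in $(B,\circ)$). The identity of $(B,\circ)$ is $1_{\circ}$. It is completely simple if $(B,\cdot)$ is. $1_{\circ}B=\{1_{\circ}b\mid b\in B\}$, $B1_{\circ}=\{b1_{\circ}\mid b\in B\}$, and $G=1_{\circ}B1_{\circ}=\{1_{\circ}b1_{\circ}\mid b\in B\}$, which is a group under $\cdot$ when $B$ is completely simple. Maps: $\lambda_a(b)=a\circ(\overline{a}b)$ and $\rho_a(b)=\overline{(\overline{b}a)}\circ a$ for $a,b\in B$. $\rho:a\mapsto\rho_a$ is an anti-homomorphism if $\rho_{a\circ b}=\rho_b\rho_a$ (composition of maps) for all $a,b\in B$. Ideal: a subsemigroup $I$ of $(B,\cdot)$ such that (1) $(I\cap G,\cdot)$ is a normal subgroup of $(G,\cdot)$; (2) $(I,\circ)$ is a normal subgroup of $(B,\circ)$; (3) $\rho_b(I)\subseteq I$ for all $b\in 1_{\circ}B$; (4) $\lambda_a(I)\subseteq I$ for all $a\in B1_{\circ}$.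 *)

(* Defs.v *)
From HB Require Import structures.
From mathcomp Require Import all_boot.
From mathcomp Require Import boolp classical_sets.

Set Implicit Arguments.
Unset Strict Implicit.
Unset Printing Implicit Defensive.

Local Open Scope group_scope.
Local Open Scope classical_set_scope.

Section SemigroupNotions.
Variables (T : Type) (op : T -> T -> T).
Implicit Types (H K J : set T) (e f : T).

Definition op_closed H : Prop := forall x y, H x -> H y -> H (op x y).

Definition subsemigroup H : Prop := H !=set0 /\ op_closed H.

Definition two_sided_ideal J : Prop :=
  J !=set0 /\ forall s x, J x -> J (op s x) /\ J (op x s).

Definition simple_semigroup : Prop :=
  forall J, two_sided_ideal J -> J = [set: T].

Definition idempotent_elt e : Prop := op e e = e.

(* Minimal for the natural order on idempotents: f <= e iff ef = fe = f. *)
Definition primitive_idempotent e : Prop :=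
  idempotent_elt e /\
  forall f, idempotent_elt f -> op e f = f -> op f e = f -> f = e.

Definition completely_simple : Prop :=
  [/\ associative op, simple_semigroup & exists e, primitive_idempotent e].

Definition identity_on H e : Prop :=
  H e /\ forall x, H x -> op e x = x /\ op x e = x.

Definition inverse_on H x y : Prop :=
  H y /\ identity_on H (op x y) /\ identity_on H (op y x).

(* (H, op) is a group.  Its identity is not a parameter. *)
Definition group_on H : Prop :=
  [/\ op_closed H,
      forall x y z, H x -> H y -> H z -> op x (op y z) = op (op x y) z,
      exists e, identity_on H e &
      forall x, H x -> exists y, inverse_on H x y].

Definition normal_subgroup H K : Prop :=
  [/\ group_on K, group_on H, H `<=` K &
      forall k k' h, K k -> inverse_on K k k' -> H h -> H (op (op k h) k')].

End SemigroupNotions.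

(* The MathComp group structure on B is (B, o): 1 is 1_o and a^-1 is a-bar.
   The semigroup operation of B is sdot.  The choice structure contained in
   groupType is no restriction: classically every type carries one. *)
HB.mixin Record Group_isLeftSemiBrace B of Group B := {
  sdot : B -> B -> B;
  sdotA : associative sdot;
  sdot_distr : forall a b c : B,
    a * sdot b c = sdot (a * b) (a * sdot a^-1 c)
}.

#[short(type="leftSemiBraceType")]
HB.structure Definition LeftSemiBrace :=
  { B of Group B & Group_isLeftSemiBrace B }.

Declare Scope semibrace_scope.
Delimit Scope semibrace_scope with SB.

Notation "a ∘ b" := (@mul _ a b) (at level 40, left associativity)
  : semibrace_scope.
Notation "a · b" := (@sdot _ a b) (at level 40, left associativity)
  : semibrace_scope.

Local Open Scope semibrace_scope.

Section LeftSemiBraceNotions.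
Variable B : leftSemiBraceType.
Implicit Types (a b x : B) (I : set B).

Definition completely_simple_semibrace : Prop := completely_simple (@sdot B).

Definition lambda a : B -> B := fun b => a ∘ (a^-1 · b).
Definition rho a : B -> B := fun b => (b^-1 · a)^-1 ∘ a.

Definition rho_antihom : Prop := forall a b, rho (a ∘ b) = rho b \o rho a.

Definition oneB : set B := [set 1 · b | b in [set: B]].
Definition Bone : set B := [set b · 1 | b in [set: B]].
Definition oneBone : set B := [set 1 · b · 1 | b in [set: B]].

Definition semibrace_ideal I : Prop :=
  subsemigroup (@sdot B) I /\
  [/\ normal_subgroup (@sdot B) (I `&` oneBone) oneBone,
      normal_subgroup (@mul B) I [set: B],
      forall b, oneB b -> rho b @` I `<=` I &
      forall a, Bone a -> lambda a @` I `<=` I].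

Definition Soc : set B :=
  [set x | lambda x = lambda 1 /\ rho x = rho 1].

End LeftSemiBraceNotions.

Arguments Soc B : clear implicits.

(* Main.v *)
Require Import Defs.
From mathcomp Require Import all_boot.
From mathcomp Require Import classical_sets.

(** Write [1] for the identity of [(B, ∘)].  Distributivity with [a = 1] says
    that [1] is a middle unit of the semigroup: [b · 1 · c = b · c]
    ([sdot_one_middle]).  In a completely simple semigroup a middle unit [m]
    is idempotent and [mBm] is a group with identity [m]
    ([middle_unit_idempotent], [middle_unit_group]); the reason is that the
    sandwich matrix of a Rees matrix representation is then of rank one, so
    that the semigroup is a rectangular group, in which every idempotent is a
    middle unit.  Hence [1 · 1 = 1] and [G = 1B1] is a group with
    identity [1].

    Unfolding [lambda] and [rho], an element [x] of the socle satisfies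
    [x ∘ (1 · b) = x · b] and [x ∘ (c · 1) = c · x] for all [b] and [c]
    ([Soc_mul_oneL], [Soc_mul_oneR]).  Taking [b = c = 1] gives [x ∈ G], and for
    [g ∈ G] both formulas apply to [x ∘ g], so [x ∘ g = x · g = g · x].  Thus
    the socle is central in [(G, ·)], and its two operations agree.

    Since [lambda] is always a homomorphism and [rho] is assumed to be an
    anti-homomorphism, the elements on which both take the same value as at
    [1] form a normal subgroup of [(B, ∘)]; as the socle is central in
    [(G, ·)] and the operations agree on it, it is also a normal subgroup
    there.

    For [b ∈ 1B], [rho b] acts on the socle as a conjugation of [(B, ∘)].
    For any [a], [lambda a] sends [x] to [(a ∘ x ∘ a^-1) ∘ lambda a 1], so it
    remains to see that [lambda a 1 = 1] for [a ∈ B1].  In fact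
    [a · lambda a 1 = a] for every [a], and for [a ∈ B1] one can cancel [a] on
    the left because [1 · a] lies in the group [G] ([lambda_Bone_one]). *)

Set Implicit Arguments.
Unset Strict Implicit.
Unset Printing Implicit Defensive.

Local Open Scope group_scope.
Local Open Scope classical_set_scope.

(** * Middle units of completely simple semigroups *)

Section MiddleUnit.
Variables (T : Type) (op : T -> T -> T).
Local Infix "*" := op.

Definition middle_unit (m : T) : Prop := forall x y, x * m * y = x * y.

Hypothesis opA : associative op.
Hypothesis op_simple : simple_semigroup op.

Lemma simple_factor x z : exists b c, z = b * x * c.
Proof.
pose J := [set z | exists b c, z = b * x * c].
suff JT : J = [set: T] by have : J z by rewrite JT.
apply: op_simple; split; first by exists (x * x * x), x, x.
by move=> s _ [b [c ->]]; split; [exists (s * b), c | exists b, (c * s)];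
  rewrite !opA.
Qed.

(** If [e = b x c] with [b, c] in [eTe], then [x c b] and [c b x] are
    idempotents below [e], hence equal to [e] by primitivity. *)
Lemma primitive_local_inverse e x :
    primitive_idempotent op e -> e * x = x -> x * e = x ->
  exists y, [/\ e * y = y, y * e = y, x * y = e & y * x = e].
Proof.
move=> [ee e_min] ex xe; have [b0 [c0 def_e]] := simple_factor x e.
pose b := e * b0 * e; pose c := e * c0 * e.
have eb: e * b = b by rewrite /b !opA ee.
have be: b * e = b by rewrite /b -!opA ee.
have ec: e * c = c by rewrite /c !opA ee.
have ce: c * e = c by rewrite /c -!opA ee.
have bxc: b * x * c = e.
  have -> : b * x * c = e * (b0 * (e * x * e) * c0) * e by rewrite /b /c !opA.
  by rewrite ex xe -def_e !ee.
clearbody b c; exists (c * b); split.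
- by rewrite opA ec.
- by rewrite -opA be.
- apply: e_min; rewrite /idempotent_elt.
  + have -> : x * (c * b) * (x * (c * b)) = x * (c * (b * x * c) * b)
      by rewrite !opA.
    by rewrite bxc ce.
  + by rewrite opA ex.
  + by rewrite -!opA be.
- apply: e_min; rewrite /idempotent_elt.
  + have -> : c * b * x * (c * b * x) = c * (b * x * c) * b * x
      by rewrite !opA.
    by rewrite bxc ce.
  + by rewrite !opA ec.
  + by rewrite -!opA xe.
Qed.

Lemma identity_on_unique (H : set T) a b :
  identity_on op H a -> identity_on op H b -> a = b.
Proof.
by move=> [Ha a_id] [Hb b_id]; rewrite -(a_id b Hb).1 (b_id a Ha).2.
Qed.

Variables m e : T.
Hypothesis m_middle : middle_unit m.
Hypothesis e_prim : primitive_idempotent op e.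

(** For [m = u e v], the elements [e u e] and [e v e] of the group [eTe] are
    mutually inverse, because their product is [e m e = e]. *)
Lemma middle_unit_factor : exists u v,
  [/\ m = u * e * v, e * u * e * v * e = e & e * v * e * u * e = e].
Proof.
have ee : e * e = e := e_prim.1.
have [u [v def_m]] := simple_factor e m; exists u, v.
have uv: e * u * e * v * e = e.
  have -> : e * u * e * v * e = e * m * e by rewrite def_m !opA.
  by rewrite m_middle.
have [|| y [_ ye _ yu]] := primitive_local_inverse (x := e * u * e) e_prim.
- by rewrite !opA ee.
- by rewrite -!opA ee.
split=> //; rewrite -[RHS]yu.
suff -> : y = e * v * e by rewrite !opA -[_ * e * e]opA ee.
rewrite -ye -[e in LHS]uv.
have -> : y * (e * u * e * v * e) = y * (e * u * e) * v * e by rewrite !opA.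
by rewrite yu.
Qed.

(** In [x y = x m y = x u e v y], the factor [u] between [x] and [e] can be
    replaced by [e u e], and [v] by [e v e]; these cancel by
    [middle_unit_factor], leaving [x e y]. *)
Lemma primitive_idempotent_middle : middle_unit e.
Proof.
have ee : e * e = e := e_prim.1.
have [u [v [def_m uv vu]]] := middle_unit_factor => x y.
have xue : x * e * u * e = x * u * e.
  rewrite -[x * e](m_middle x e) def_m.
  have -> : x * (u * e * v) * e * u * e = x * u * (e * v * e * u * e)
    by rewrite !opA.
  by rewrite vu.
have evy : e * v * e * y = e * v * y.
  rewrite -[RHS]opA -[e * v * e * y]opA -[in LHS](m_middle e y) def_m.
  have -> : e * v * (e * (u * e * v) * y) = e * v * e * u * e * (v * y)
    by rewrite !opA.
  by rewrite vu.
rewrite -(m_middle x y) def_m.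
have -> : x * (u * e * v) * y = x * u * e * v * y by rewrite !opA.
have -> : x * u * e * v * y = x * u * (e * v * y) by rewrite !opA.
rewrite -evy.
have -> : x * u * (e * v * e * y) = x * u * e * v * e * y by rewrite !opA.
rewrite -xue.
have -> : x * e * u * e * v * e * y = x * (e * u * e * v * e) * y
  by rewrite !opA.
by rewrite uv.
Qed.

(** Since [e] is a middle unit, [e f e] is an idempotent below [e], hence
    equal to [e]; therefore [x f y = x (e f e) y = x e y = x y]. *)
Lemma idempotent_middle f : idempotent_elt op f -> middle_unit f.
Proof.
have ee : e * e = e := e_prim.1; have e_mid := primitive_idempotent_middle.
move=> ff x y.
have efe : e * f * e = e.
  apply: e_prim.2.
  - by rewrite /idempotent_elt !opA !e_mid -[e * f * f]opA ff.
  - by rewrite !opA ee.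
  - by rewrite -opA ee.
have <- : x * e * f * e * y = x * f * y by rewrite !e_mid.
have -> : x * e * f * e * y = x * (e * f * e) * y by rewrite !opA.
by rewrite efe e_mid.
Qed.

Lemma middle_unit_idempotent : idempotent_elt op m.
Proof.
have [u [v [def_m _ vu]]] := middle_unit_factor.
have e_mid := primitive_idempotent_middle.
have evue : e * v * u * e = e by rewrite -[e * v * u]e_mid vu.
rewrite /idempotent_elt [in LHS]def_m.
have -> : u * e * v * (u * e * v) = u * e * v * u * e * v by rewrite !opA.
have -> : u * e * v * u * e * v = u * (e * v * u * e) * v by rewrite !opA.
by rewrite evue -def_m.
Qed.

(** If [e = b x c], then [x c b] is an idempotent because [e] is a middle unit;
    idempotents being middle units, [m x c b m = m], so [m c b m] is the
    inverse of [m x m]; similarly on the other side. *)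
Lemma middle_unit_local_inverse x : exists y,
  m * x * m * (m * y * m) = m /\ m * y * m * (m * x * m) = m.
Proof.
have mm : m * m = m := middle_unit_idempotent.
have e_mid := primitive_idempotent_middle.
have [b [c def_e]] := simple_factor x e; exists (c * b).
have mfm f : idempotent_elt op f -> m * f * m = m.
  by move/idempotent_middle ->; rewrite mm.
have bxc z w : z * b * x * c * w = z * w.
  by rewrite -(e_mid z w) def_e !opA.
split.
- rewrite -[RHS](mfm (x * c * b)).
    by rewrite !opA !m_middle.
  rewrite /idempotent_elt !opA.
  by have -> : x * c * b * x * c * b = x * c * b by rewrite bxc.
- rewrite -[RHS](mfm (c * b * x)).
    by rewrite !opA !m_middle.
  rewrite /idempotent_elt !opA.
  by have -> : c * b * x * c * b * x = c * b * x by rewrite bxc.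
Qed.

Lemma middle_unit_group :
  group_on op [set m * b * m | b in [set: T]] /\
  identity_on op [set m * b * m | b in [set: T]] m.
Proof.
have mm : m * m = m := middle_unit_idempotent.
have m_id : identity_on op [set m * b * m | b in [set: T]] m.
  split; first by exists m; rewrite // !mm.
  by move=> _ [x _ <-]; rewrite !opA mm -[X in _ /\ X = _]opA mm.
split=> //; split.
- by move=> _ _ [x _ <-] [y _ <-]; exists (x * m * y); rewrite // !opA !m_middle.
- by move=> x y z _ _ _; rewrite opA.
- by exists m.
- move=> _ [x _ <-]; have [y [xy yx]] := middle_unit_local_inverse x.
  by exists (m * y * m); split; [exists y | rewrite xy yx].
Qed.

End MiddleUnit.

Local Open Scope semibrace_scope.

(** * The socle in the group (B, ∘) *)

Section Socle.
Variable B : leftSemiBraceType.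
Implicit Types a b c x y : B.

(** Distributivity for [a = 1] reads [b · c = b · (1 · c)]. *)
Lemma sdot_one_middle : middle_unit (@sdot B) 1.
Proof.
by move=> b c; rewrite -sdotA -[RHS]mul1g sdot_distr invg1 !mul1g.
Qed.

(** A restatement of [invgM] whose terms are typed by the canonical group
    structure of [B], so that they can be matched in rewriting. *)
Lemma mulg_inv a b : (a ∘ b)^-1 = b^-1 ∘ a^-1.
Proof. exact: invgM. Qed.

Lemma lambdaM a b : lambda (a ∘ b) = lambda a \o lambda b.
Proof.
apply/boolp.funext => c; rewrite /lambda /= -mulgA; congr (_ ∘ _).
by rewrite sdot_distr mulg_inv mulVKg.
Qed.

(** Distributivity gives [x ∘ (1 · b) = x · lambda x b], and here
    [lambda x b = 1 · b]. *)
Lemma Soc_mul_oneL x b : Soc B x -> x ∘ (1 · b) = x · b.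
Proof.
move=> [xl _]; rewrite sdot_distr -/(lambda x b) xl.
by rewrite /lambda mul1g mulg1 invg1 sdotA sdot_one_middle.
Qed.

(** The equation [rho x = rho 1] at [c^-1], inverted on both sides, reads
    [x^-1 ∘ (c · x) = c · 1]. *)
Lemma Soc_mul_oneR x c : Soc B x -> x ∘ (c · 1) = c · x.
Proof.
move=> [_ xr]; have := congr1 (fun f => (f c^-1)^-1) xr.
by rewrite /rho /= !mulg_inv !invgK invg1 mul1g => <-; rewrite mulVKg.
Qed.

Section AntiHom.
Hypothesis rhoM : rho_antihom B.

Lemma Soc1 : Soc B 1.
Proof. by []. Qed.

Lemma SocM x y : Soc B x -> Soc B y -> Soc B (x ∘ y).
Proof.
move=> [xl xr] [yl yr]; split.
  by rewrite lambdaM xl yl -lambdaM mulg1.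
by rewrite rhoM xr yr -rhoM mulg1.
Qed.

Lemma Soc_conj a x : Soc B x -> Soc B (a ∘ x ∘ a^-1).
Proof.
move=> [xl xr]; split.
  by rewrite !lambdaM xl -!lambdaM mulg1 mulgV.
by rewrite -mulgA !rhoM xr -!rhoM mul1g mulgV.
Qed.

Lemma SocV x : Soc B x -> Soc B x^-1.
Proof.
move=> [xl xr]; split.
  by rewrite -[in LHS](mul1g x^-1) lambdaM -xl -lambdaM mulgV.
by rewrite -[in LHS](mulg1 x^-1) rhoM -xr -rhoM mulVg.
Qed.

Lemma Soc_normal : normal_subgroup (@mul B) (Soc B) [set: B].
Proof.
have one_id (H : set B) : H 1 -> identity_on (@mul B) H 1.
  by move=> H1; split=> // x _; rewrite mul1g mulg1.
have inv_id (H : set B) x : H 1 -> H x^-1 -> inverse_on (@mul B) H x x^-1.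
  by move=> H1 Hx; split=> //; rewrite mulgV mulVg; split; apply: one_id.
split=> //.
- split=> //; first by move=> x y z _ _ _; rewrite mulgA.
  + by exists 1; apply: one_id.
  + by move=> x _; exists x^-1; apply: inv_id.
- split.
  + exact: SocM.
  + by move=> x y z _ _ _; rewrite mulgA.
  + by exists 1; apply: one_id.
  + by move=> x Sx; exists x^-1; apply: inv_id => //; apply: SocV.
- move=> k k' h _ [_ [[_ kk'1] _]] Sh.
  have /mulg1_eq <- : k ∘ k' = 1.
    by have [] := kk'1 1 Logic.I; rewrite mulg1.
  exact: Soc_conj.
Qed.

End AntiHom.

(** * The socle in the group (1B1, ·) *)

Hypothesis B_cs : completely_simple_semibrace B.

Lemma sdot11 : 1 · 1 = 1 :> B.
Proof.
have [A simp [e e_prim]] := B_cs.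
exact: middle_unit_idempotent sdot_one_middle e_prim.
Qed.

Lemma oneBoneP x : oneBone x <-> 1 · x = x /\ x · 1 = x.
Proof.
split=> [[b _ <-]|[xl xr]]; last by exists x; rewrite // xl xr.
by rewrite !sdotA sdot11 -[X in _ /\ X = _]sdotA sdot11.
Qed.

Lemma oneBone_group :
  group_on (@sdot B) (@oneBone B) /\ identity_on (@sdot B) (@oneBone B) 1.
Proof.
have [A simp [e e_prim]] := B_cs.
exact: middle_unit_group sdot_one_middle e_prim.
Qed.

Lemma inverse_on_oneBone x y :
  inverse_on (@sdot B) (@oneBone B) x y -> x · y = 1 /\ y · x = 1.
Proof.
have one_id := oneBone_group.2.
by move=> [_ [xy yx]]; split; apply: identity_on_unique one_id.
Qed.

(** Distributivity on [a = a ∘ (1 · 1)] gives [a · f = a] for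
    [f = lambda a 1], and [1 · f = f].  If [a = a · 1], then [1 · a] has an
    inverse [h] in [1B1], so [f = h · (1 · a) · f = h · (1 · a) = 1]. *)
Lemma lambda_Bone_one a : Bone a -> lambda a 1 = 1.
Proof.
move=> [b _ def_a]; have a1 : a · 1 = a by rewrite -def_a -sdotA sdot11.
have af : a · lambda a 1 = a.
  by rewrite -[X in X · _]mulg1 -sdot_distr sdot11 mulg1.
have f1 : 1 · lambda a 1 = lambda a 1.
  by rewrite -[in RHS](mul1g a) lambdaM /= /lambda mul1g invg1.
have [] := oneBone_group; case=> _ _ _ /(_ (1 · a)) ginv _.
have [|h /inverse_on_oneBone[_ ha]] := ginv.
  by exists a; rewrite // -sdotA a1.
by rewrite -f1 -[X in X · _]ha -!sdotA af ha.
Qed.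

Lemma Soc_oneBone x : Soc B x -> oneBone x.
Proof.
move=> Sx; apply/oneBoneP; split.
  by rewrite -Soc_mul_oneR // sdot11 mulg1.
by rewrite -Soc_mul_oneL // sdot11 mulg1.
Qed.

Lemma Soc_sdotl x g : Soc B x -> oneBone g -> x · g = x ∘ g.
Proof. by move=> Sx /oneBoneP[gl _]; rewrite -Soc_mul_oneL // gl. Qed.

Lemma Soc_sdotr x g : Soc B x -> oneBone g -> g · x = x ∘ g.
Proof. by move=> Sx /oneBoneP[_ gr]; rewrite -Soc_mul_oneR // gr. Qed.

Hypothesis rhoM : rho_antihom B.

Lemma Soc_sdot_closed : op_closed (@sdot B) (Soc B).
Proof.
move=> x y Sx Sy; rewrite Soc_sdotl //; last exact: Soc_oneBone.
exact: SocM.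
Qed.

(** By [Soc_sdotl] and [Soc_sdotr] the socle is central in [1B1], so that
    conjugation in [1B1] fixes it pointwise. *)
Lemma Soc_sdot_normal :
  normal_subgroup (@sdot B) (Soc B `&` @oneBone B) (@oneBone B).
Proof.
have SG x : Soc B x -> (Soc B `&` @oneBone B) x.
  by move=> Sx; split=> //; apply: Soc_oneBone.
have [G_group [_ one_id]] := oneBone_group.
have id1 : identity_on (@sdot B) (Soc B `&` @oneBone B) 1.
  by split; [apply/SG/Soc1 | move=> x [_ /one_id]].
split=> //.
- split.
  + by move=> x y [Sx _] [Sy _]; apply/SG/Soc_sdot_closed.
  + by move=> x y z _ _ _; rewrite sdotA.
  + by exists 1.
  + move=> x [Sx _]; exists x^-1; have SVx := SocV rhoM Sx.
    split; first exact: SG.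
    by rewrite !Soc_sdotl ?mulgV ?mulVg //; apply: Soc_oneBone.
- move=> k k' h Gk kk' [Sh _]; apply: SG.
  rewrite [k · h]Soc_sdotr // -Soc_sdotl // -sdotA (inverse_on_oneBone kk').1.
  by have [_ ->] := one_id _ (Soc_oneBone Sh).
Qed.

End Socle.

Theorem proposition4p9 (B : leftSemiBraceType)
    (B_completely_simple : completely_simple_semibrace B)
    (rho_antihomB : rho_antihom B) :
  semibrace_ideal (Soc B).
Proof.
split; first by split; [exists 1; apply: Soc1 | apply: Soc_sdot_closed].
split; [exact: Soc_sdot_normal | exact: Soc_normal | |].
- move=> _ [c _ <-] _ [x Sx <-]; have SVx := SocV rho_antihomB Sx.
  (* The definition of [rho] contains [x^-1 · (1 · c)], which is
     [x^-1 ∘ (1 · c)] since [x^-1] is in the socle. *)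
  have -> : rho (1 · c) x = (1 · c)^-1 ∘ x ∘ (1 · c)^-1^-1.
    rewrite /rho -Soc_mul_oneL // sdotA sdot11 //.
    by rewrite mulg_inv !invgK.
  exact: Soc_conj.
- move=> a Ba _ [x Sx <-].
  (* [a^-1 · x = x ∘ (a^-1 · 1)] and [a ∘ (a^-1 · 1) = lambda a 1]. *)
  suff -> : lambda a x = a ∘ x ∘ a^-1 by apply: Soc_conj.
  have : a ∘ x ∘ a^-1 ∘ lambda a 1 = lambda a x.
    by rewrite /lambda -[a^-1 · x]Soc_mul_oneR // -!mulgA mulKg.
  by rewrite lambda_Bone_one // mulg1.
Qed.
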